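(* Let $\phi:\mathbb{R}^n\to\mathbb{R}$ be a reference function with $\operatorname{dom}\phi=\mathbb{R}^n$, and let $f\in\mathcal{C}^1(\mathbb{R}^n)$ be anisotropically smooth relative to $\phi$ with constant $L>0$ and satisfy $f_\star=\inf f>-\infty$. Let $g$ be a stochastic first-order oracle such that $$\mathbb{E}\left[\phi\big(\nabla\phi^*(\nabla f(x))-\nabla\phi^*(g(x))\big)\right]\le\sigma^2\qquad\text{for all }x\in\mathbb{R}^n .$$ Let $x^0\in\mathbb{R}^n$ and let $\{x^k\}$ be generated by $x^{k+1}=x^k-\gamma\nabla\phi^*(g(x^k))$ with stepsize $0<\gamma\le\frac1L$. Then, for every integer $K\ge1$, $$\mathbb{E}\left[\frac1K\sum_{k=0}^{K-1}\phi(\nabla\phi^*(\nabla f(x^k)))\right]\le\frac{f(x^0)-f_\star}{\gamma K}+\sigma^2 .$$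
   Context: $\|\cdot\|$ is the Euclidean norm on $\mathbb{R}^n$; $\phi^*$ is the convex conjugate of $\phi$. Reference function (with full domain): $\phi:\mathbb{R}^n\to\mathbb{R}$ is strongly convex and even with $\phi(0)=0$, and $\phi\in\mathcal{C}^2(\mathbb{R}^n)$. (Then $\phi^*\in\mathcal{C}^2(\mathbb{R}^n)$.) Episcaling: for $\lambda>0$, $(\lambda\star\phi)(x)=\lambda\phi(\lambda^{-1}x)$. Anisotropic smoothness: $f\in\mathcal{C}^1(\mathbb{R}^n)$ is anisotropically smooth relative to $\phi$ with constant $L>0$ if for all $x,\bar x\in\mathbb{R}^n$ $$f(x)\le f(\bar x)+\left(\tfrac1L\star\phi\right)(x-\bar y)-\left(\tfrac1L\star\phi\right)(\bar x-\bar y),\qquad \bar y=\bar x-\tfrac1L\nabla\phi^*(\nabla f(\bar x)).$$ Stochastic oracle: when queried at a point $x$, it returns a random vector $g(x)\in\mathbb{R}^n$ (a stochastic gradient; no unbiasedness is assumed). The call at each iteration uses fresh randomness, so that conditionally on $x^k$ the vector $g(x^k)$ is distributed as the oracle's output at the point $x^k$; the initial point $x^0$ is deterministic. *)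

(* Defs.v *)
From HB Require Import structures.
From mathcomp Require Import all_boot all_order all_algebra.
From mathcomp Require Import all_classical all_reals all_analysis.

Set Implicit Arguments.
Unset Strict Implicit.
Unset Printing Implicit Defensive.

Import Order.TTheory GRing.Theory Num.Theory.
Import numFieldNormedType.Exports.

Local Open Scope classical_set_scope.
Local Open Scope ring_scope.

Section Euclidean.
Context {R : realType} {n : nat}.
Implicit Types (x y : 'rV[R]_n) (phi f : 'rV[R]_n -> R).

Definition dot x y : R := \sum_(i < n) x 0 i * y 0 i.

(* The library norm on 'rV[R]_n is the sup norm, hence this separate one. *)
Definition enorm x : R := Num.sqrt (dot x x).

Definition grad f x : 'rV[R]_n := \row_(i < n) 'D_(delta_mx 0 i) f x.

Definition C1 f : Prop := (forall x, differentiable f x) /\ continuous (grad f).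

Definition C2 f : Prop := C1 f /\ forall i : 'I_n, C1 (fun x => grad f x 0 i).

Definition strongly_convex phi : Prop :=
  exists2 mu : R, 0 < mu &
    forall x y (t : R), 0 <= t <= 1 ->
      phi (t *: x + (1 - t) *: y) <=
      t * phi x + (1 - t) * phi y - mu / 2 * t * (1 - t) * enorm (x - y) ^+ 2.

Definition conjugate phi y : \bar R :=
  ereal_sup (range (fun x => (dot x y - phi x)%:E)).

(* [fine] loses nothing when phi is continuous and strongly convex on the
   whole space, for then the conjugate is finite everywhere. *)
Definition grad_conj phi : 'rV[R]_n -> 'rV[R]_n := grad (fine \o conjugate phi).

Definition reference_function phi : Prop :=
  [/\ strongly_convex phi, (forall x, phi (- x) = phi x), phi 0 = 0 & C2 phi].

Definition episcale (lambda : R) phi x : R := lambda * phi (lambda^-1 *: x).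

Definition anisotropically_smooth phi (L : R) f : Prop :=
  forall x xbar,
    let ybar := xbar - L^-1 *: grad_conj phi (grad f xbar) in
    f x <= f xbar + episcale L^-1 phi (x - ybar)
                  - episcale L^-1 phi (xbar - ybar).

End Euclidean.

(* R^n with its Borel sigma-algebra. *)
Definition borel_rV (R : realType) (n : nat) :=
  g_sigma_algebraType (@open 'rV[R]_n).

(* A stochastic oracle is given by the laws of its outputs: Q x is the
   distribution of the random vector g(x) returned at the query point x. *)
Definition oracle (R : realType) (n : nat) :=
  R.-pker (borel_rV R n) ~> (borel_rV R n).

(* Conditionally on X, the random vector G has law Q X. *)
Definition conditionally_distributed (R : realType) (n : nat)
    (d : measure_display) (Omega : measurableType d) (P : probability Omega R)
    (Q : oracle R n) (X G : Omega -> 'rV[R]_n) : Prop :=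
  forall A B : set (borel_rV R n), measurable A -> measurable B ->
    P (X @^-1` A `&` G @^-1` B) = (\int[P]_(w in X @^-1` A) Q (X w) B)%E.

(* Main.v *)
(* Write a = grad phi^*(grad f x) and v = grad phi^*(g). Anisotropic smoothness
   at the step x - gamma v bounds f(x - gamma v) by
   f x + phi(a - L gamma v) / L - phi a / L, and since
   a - L gamma v = L gamma (a - v) + (1 - L gamma) a, convexity of phi gives
   gamma phi(a) <= f x - f(x - gamma v) + gamma phi(a - v). These inequalities
   telescope pointwise along the trajectory, every term being nonnegative, and
   taking expectations only requires the bound on E phi(a_k - v_k), obtained by
   disintegrating the joint law of (x_k, g_k) along the oracle kernel.
   Measurability of the iterates comes from the continuity of grad phi^*, which
   is the Lipschitz map sending y to the maximizer of <x, y> - phi x. *)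
Require Import Defs.
From HB Require Import structures.
From mathcomp Require Import all_boot all_order all_algebra.
From mathcomp Require Import all_classical all_reals all_analysis.
From mathcomp Require Import measurable_realfun ring lra.

Set Implicit Arguments.
Unset Strict Implicit.
Unset Printing Implicit Defensive.

Import Order.TTheory GRing.Theory Num.Theory.
Import numFieldNormedType.Exports.

Local Open Scope classical_set_scope.
Local Open Scope ring_scope.

(** * Euclidean inner product, and the Euclidean norm against the sup norm *)

Section InnerProduct.
Context {R : realType} {n : nat}.
Implicit Types x y z : 'rV[R]_n.

Lemma dotC x y : dot x y = dot y x.
Proof. by apply: eq_bigr => i _; rewrite mulrC. Qed.

Lemma dotDl x y z : dot (x + y) z = dot x z + dot y z.
Proof.
by rewrite /dot -big_split; apply: eq_bigr => i _; rewrite mxE mulrDl.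
Qed.

Lemma dotZl (a : R) x y : dot (a *: x) y = a * dot x y.
Proof. by rewrite /dot mulr_sumr; apply: eq_bigr => i _; rewrite mxE mulrA. Qed.

Lemma dotNl x y : dot (- x) y = - dot x y.
Proof. by rewrite -scaleN1r dotZl mulN1r. Qed.

Lemma dotBl x y z : dot (x - y) z = dot x z - dot y z.
Proof. by rewrite dotDl dotNl. Qed.

Lemma dotDr x y z : dot x (y + z) = dot x y + dot x z.
Proof. by rewrite dotC dotDl !(dotC x). Qed.

Lemma dotZr (a : R) x y : dot x (a *: y) = a * dot x y.
Proof. by rewrite dotC dotZl dotC. Qed.

Lemma dotBr x y z : dot x (y - z) = dot x y - dot x z.
Proof. by rewrite dotC dotBl !(dotC x). Qed.

Lemma dot0l x : dot 0 x = 0.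
Proof. by rewrite -(scale0r x) dotZl mul0r. Qed.

Lemma dot_delta x i : dot x (delta_mx 0 i) = x 0 i.
Proof.
rewrite /dot (bigD1 i)//= mxE !eqxx mulr1 big1 ?addr0// => j /negPf ji.
by rewrite mxE ji andbF mulr0.
Qed.

Lemma dot_ge0 x : 0 <= dot x x.
Proof. by apply: sumr_ge0 => i _; rewrite -expr2 sqr_ge0. Qed.

Lemma sqr_enorm x : enorm x ^+ 2 = dot x x.
Proof. by rewrite sqr_sqrtr// dot_ge0. Qed.

Lemma ler_coord_enorm x i : `|x 0 i| <= enorm x.
Proof.
rewrite -sqrtr_sqr ler_wsqrtr// /dot (bigD1 i)//= expr2 lerDl.
by apply: sumr_ge0 => j _; rewrite -expr2 sqr_ge0.
Qed.

(** Each of the [n] squares is at most the squared sup norm. Together with [norm_le_enorm] this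
    carries Euclidean Lipschitz bounds over to the topology of ['rV[R]_n]. *)
Lemma enorm_le_norm x : enorm x <= Num.sqrt n%:R * `|x|.
Proof.
rewrite -[`|x|]ger0_norm// -sqrtr_sqr -sqrtrM// ler_wsqrtr//.
rewrite /dot (le_trans (ler_sum _ (G := fun=> `|x| ^+ 2) _))//.
  move=> i _; rewrite -expr2 -real_normK ?num_real// lerXn2r ?nnegrE//.
  rewrite [leRHS]/Num.norm /= mx_normrE.
  by apply/bigmax_geP; right; exists (ord0, i).
by rewrite sumr_const card_ord mulr_natl.
Qed.

Lemma norm_le_enorm x : `|x| <= enorm x.
Proof.
rewrite [leLHS]/Num.norm /= mx_normrE; apply/bigmax_leP; split => /=.
  exact: sqrtr_ge0.
by move=> [i j] _ /=; rewrite (ord1 i) ler_coord_enorm.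
Qed.

Lemma continuous_dotl y : continuous (dot ^~ y).
Proof.
apply: (@continuous_big _ _ _ _ _ add_continuous) => i _ x.
apply: (@continuousM R _ (fun v : 'rV[R]_n => v 0 i) (fun=> y 0 i)).
  exact: (@coord_continuous R 1 n 0 i).
exact: cst_continuous.
Qed.

End InnerProduct.

(** * Gradient of the conjugate of an even strongly convex function *)

Section Conjugate.
Context {R : realType} {n : nat} (phi : 'rV[R]_n -> R) (mu : R).
Hypothesis mu_gt0 : 0 < mu.
Hypothesis phi_sc : forall x y (t : R), 0 <= t <= 1 ->
  phi (t *: x + (1 - t) *: y) <=
  t * phi x + (1 - t) * phi y - mu / 2 * t * (1 - t) * enorm (x - y) ^+ 2.
Hypothesis phi_even : forall x, phi (- x) = phi x.
Hypothesis phi0 : phi 0 = 0.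
Hypothesis phi_cont : continuous phi.
Implicit Types x y z p q : 'rV[R]_n.

(* Evenness: apply strong convexity at the midpoint of [x] and [- x]. *)
Lemma quadratic_growth x : mu / 2 * dot x x <= phi x.
Proof.
have half01 : 0 <= (2^-1 : R) <= 1 by apply/andP; split; lra.
have := phi_sc x (- x) half01.
have -> : 1 - 2^-1 = 2^-1 :> R by lra.
rewrite scalerN subrr phi0 phi_even opprK sqr_enorm dotDl !dotDr; lra.
Qed.

(** The quadratic margin is part of the notion because it yields both uniqueness of the maximizer
    and its Lipschitz dependence on [y]. *)
Definition conjugate_maximizer y p :=
  forall x, phi p - dot p y + mu / 4 * dot (x - p) (x - p) <= phi x - dot x y.

(* By quadratic growth the sublevel set [phi x - <x, y> <= 0], which contains
   0, lies in a box around [y / mu]. *)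
Lemma exists_conjugate_maximizer y : exists p, conjugate_maximizer y p.
Proof.
pose psi x := phi x - dot x y.
(* Completing the square in [mu / 2 * dot x x <= dot x y] puts [x] within [enorm y / mu] of
   [y / mu]. *)
pose r := mu^-1 * enorm y.
have r_ge0 : 0 <= r by rewrite mulr_ge0 ?sqrtr_ge0// invr_ge0 ltW.
pose c i := mu^-1 * y 0 i.
pose A := [set v : 'rV[R]_n | forall i, v ord0 i \in `[c i - r, c i + r]].
have psi_sublevel x : psi x <= 0 -> A x.
  move=> psix i /=; rewrite in_itv/= -ler_distlC.
  have -> : c i - x 0 i = (mu^-1 *: y - x) 0 i by rewrite !mxE.
  apply: le_trans (ler_coord_enorm _ _) _.
  rewrite -ler_sqr ?nnegrE ?sqrtr_ge0// exprMn !sqr_enorm.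
  rewrite dotBl !dotBr !dotZl !dotZr (dotC y x).
  have := quadratic_growth x; rewrite /psi in psix => gr.
  have : mu^-1 * (mu / 2 * dot x x - dot x y) <= 0.
    rewrite pmulr_rle0 ?invr_gt0//; lra.
  by rewrite mulrBr !mulrA mulVf ?gt_eqF//; lra.
have psi0 : psi 0 = 0 by rewrite /psi phi0 dot0l subr0.
have A0 : A 0 by apply: psi_sublevel; rewrite psi0.
have cA : compact A.
  apply: (@rV_compact _ _ (fun i => `[c i - r, c i + r]%classic)) => i.
  exact: segment_compact.
have cpsi : continuous psi.
  move=> x; apply: (@continuousB R R _ phi (dot ^~ y)).
    exact: phi_cont.
  exact: continuous_dotl.
have [p pA pmin] := EVT_min_rV (ex_intro _ _ A0) cA
  (continuous_subspaceT cpsi).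
have {}pmin x : psi p <= psi x.
  have [/psi_sublevel Ax|psix] := leP (psi x) 0; first exact/pmin/mem_set.
  by apply: le_trans (ltW psix); rewrite -psi0; exact/pmin/mem_set.
exists p => x.
(* Minimality of [p] is tested at the midpoint of [x] and [p]; strong convexity there leaves the
   margin [mu / 4]. *)
have half01 : 0 <= (2^-1 : R) <= 1 by apply/andP; split; lra.
have := phi_sc x p half01.
have := pmin (2^-1 *: x + (1 - 2^-1) *: p).
rewrite /psi sqr_enorm (dotDl (2^-1 *: x)) !dotZl; lra.
Qed.

Definition conj_argmax y : 'rV[R]_n :=
  projT1 (cid (exists_conjugate_maximizer y)).

Lemma conj_argmaxP y : conjugate_maximizer y (conj_argmax y).
Proof. by rewrite /conj_argmax; case: cid. Qed.

(** Adding the margins of the two maximizers, each tested at the other one, cancels the values of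
    [phi] and leaves [mu / 2 * dot (p - q) (p - q) <= dot (p - q) (z - y)]. *)
Lemma conj_argmax_lipschitz y z :
  enorm (conj_argmax z - conj_argmax y) <= 2 / mu * enorm (z - y).
Proof.
set p := conj_argmax z; set q := conj_argmax y.
have cpos : 0 <= 2 / mu by rewrite divr_ge0// ltW.
have rhs_ge0 : 0 <= 2 / mu * enorm (z - y) by rewrite mulr_ge0// sqrtr_ge0.
have h1 := conj_argmaxP z q; have h2 := conj_argmaxP y p.
rewrite -/p -/q in h1 h2.
rewrite -ler_sqr ?nnegrE ?sqrtr_ge0// exprMn !sqr_enorm.
have sym : dot (q - p) (q - p) = dot (p - q) (p - q).
  by rewrite -opprB dotNl dotC dotNl opprK.
rewrite sym in h1.
have h3 : mu / 2 * dot (p - q) (p - q) <= dot (p - q) (z - y).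
  by rewrite [leRHS]dotBl !(dotBr _ z y); lra.
move: (p - q) (z - y) h3 => u v h3.
(* This square does the work of Cauchy-Schwarz: its cross term is at least [2 * dot u u] by [h3]. *)
have := dot_ge0 (u - (2 / mu) *: v).
rewrite dotBl !dotBr !dotZl !dotZr (dotC v u).
have mu0 : mu != 0 by rewrite gt_eqF.
have : 2 / mu * (mu / 2 * dot u u - dot u v) <= 0.
  by rewrite mulr_ge0_le0// subr_le0.
rewrite mulrBr (_ : 2 / mu * (mu / 2 * dot u u) = dot u u); last by field.
lra.
Qed.

(** The supremum is attained, hence finite, so [fine] is exact here. *)
Lemma conjugateE y :
  conjugate phi y = (dot (conj_argmax y) y - phi (conj_argmax y))%:E.
Proof.
apply/eqP; rewrite eq_le; apply/andP; split.
  apply: ge_ereal_sup => _ [x _ <-]; rewrite lee_fin.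
  have := conj_argmaxP y x.
  have : 0 <= mu / 4 * dot (x - conj_argmax y) (x - conj_argmax y).
    by rewrite mulr_ge0 ?dot_ge0// divr_ge0// ltW.
  lra.
by apply: ereal_sup_ubound; exists (conj_argmax y).
Qed.

(* The increments of the conjugate lie between those of its affine minorants
   at the two end points, and these differ by a Lipschitz gradient. *)
Lemma fine_conjugate_increment y z :
  0 <= fine (conjugate phi z) - fine (conjugate phi y)
       - dot (conj_argmax y) (z - y)
    <= dot (conj_argmax z - conj_argmax y) (z - y).
Proof.
rewrite !conjugateE /=.
have h1 := conj_argmaxP z (conj_argmax y).
have h2 := conj_argmaxP y (conj_argmax z).
have mu4 : 0 <= mu / 4 by rewrite divr_ge0// ltW.
have d1 := mulr_ge0 mu4 (dot_ge0 (conj_argmax y - conj_argmax z)).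
have d2 := mulr_ge0 mu4 (dot_ge0 (conj_argmax z - conj_argmax y)).
rewrite [dot (_ - _) (z - y)]dotBl !dotBr.
by apply/andP; split; lra.
Qed.

(** Envelope argument: along a coordinate step [h], the increment of the conjugate differs from its
    linear prediction by at most [h] times the displacement of the maximizer, which is of order
    [h ^+ 2] by the Lipschitz bound. *)
Lemma grad_conjE : grad_conj phi = conj_argmax.
Proof.
apply/funext => y; apply/rowP => i; rewrite /grad_conj /grad mxE.
apply: cvg_lim => //; apply/cvgrPdist_le => e e0; near=> h.
have h0 : h != 0 by near: h; exact: nbhs_dnbhs_neq.
have := fine_conjugate_increment y (h *: delta_mx 0 i + y).
rewrite addrK !dotZr !dot_delta !mxE /= => /andP[lo hi].
set D := (_ - _ in X in X - _) in lo hi *.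
have lip := conj_argmax_lipschitz y (h *: delta_mx 0 i + y).
rewrite addrK in lip.
have enh : enorm (h *: delta_mx 0 i : 'rV[R]_n) = `|h|.
  by rewrite /enorm dotZl dotZr dot_delta mxE !eqxx mulr1 -expr2 sqrtr_sqr.
have {lip}lip := le_trans (ler_coord_enorm _ i) lip.
rewrite !mxE enh in lip.
have key : `|h| * `|conj_argmax y 0 i - h^-1 *: D| <= `|h| * e.
  rewrite -normrM mulrBr /GRing.scale /= mulVKf// distrC ger0_norm//.
  apply: le_trans hi _; apply: le_trans (ler_norm _) _; rewrite normrM.
  rewrite ler_wpM2l//; apply: le_trans lip _.
  rewrite mulrC -ler_pdivlMr ?divr_gt0//.
  near: h; apply: dnbhs0_le; rewrite !divr_gt0//.
by rewrite ler_pM2l ?normr_gt0 in key.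
Unshelve. all: by end_near. Qed.

Lemma continuous_conj_argmax : continuous conj_argmax.
Proof.
move=> y; apply/(@cvgrPdist_le _ _ _ (nbhs y)) => e e0; near=> z.
apply: le_trans (norm_le_enorm _) _.
apply: le_trans (conj_argmax_lipschitz _ _) _.
rewrite mulrC -ler_pdivlMr ?divr_gt0//.
apply: le_trans (enorm_le_norm _) _.
(* The added 1 keeps the divisor positive when [n] is 0. *)
have s1 : 0 < Num.sqrt n%:R + 1 :> R by rewrite ltr_pwDr// sqrtr_ge0.
apply: (@le_trans _ _ ((Num.sqrt n%:R + 1) * `|y - z|)).
  by rewrite ler_wpM2r// lerDl.
rewrite mulrC -ler_pdivlMr//.
near: z; apply: cvgr_dist_le; first exact: cvg_id.
by rewrite !divr_gt0.
Unshelve. all: by end_near. Qed.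

End Conjugate.

(** * Reference functions and the one-step descent inequality *)

Section ReferenceFunction.
Context {R : realType} {n : nat} (phi : 'rV[R]_n -> R).
Hypothesis hphi : reference_function phi.

Lemma reference_function_continuous : continuous phi.
Proof.
by case: hphi => _ _ _ [[dphi _] _] x; exact/differentiable_continuous.
Qed.

Lemma reference_function_ge0 x : 0 <= phi x.
Proof.
case: hphi => -[mu mu0 sc] ev p0 _.
apply: le_trans (quadratic_growth sc ev p0 x).
by rewrite mulr_ge0 ?dot_ge0// divr_ge0// ltW.
Qed.

Lemma reference_function_convex x y (t : R) : 0 <= t <= 1 ->
  phi (t *: x + (1 - t) *: y) <= t * phi x + (1 - t) * phi y.
Proof.
case: hphi => -[mu mu0 sc] _ _ _ t01; apply: le_trans (sc _ _ _ t01) _.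
case/andP: t01 => t0 t1; rewrite gerBl mulr_ge0 ?sqr_ge0//.
rewrite mulr_ge0 ?subr_ge0// mulr_ge0// divr_ge0//.
exact: ltW.
Qed.

Lemma continuous_grad_conj : continuous (grad_conj phi).
Proof.
case: (hphi) => -[mu mu0 sc] ev p0 _.
rewrite (grad_conjE mu0 sc ev p0 reference_function_continuous).
exact: continuous_conj_argmax.
Qed.

Lemma anisotropic_descent (f : 'rV[R]_n -> R) (L gamma : R) (x v : 'rV[R]_n) :
    0 < L -> anisotropically_smooth phi L f -> 0 < gamma <= L^-1 ->
  gamma * phi (grad_conj phi (grad f x)) <=
  f x - f (x - gamma *: v) + gamma * phi (grad_conj phi (grad f x) - v).
Proof.
move=> L0 sm /andP[g0 gL]; set a := grad_conj phi (grad f x).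
have Ln0 : L != 0 by rewrite gt_eqF.
have e1 : L *: (x - gamma *: v - (x - L^-1 *: a)) = a - (L * gamma) *: v.
  rewrite opprB [_ + (_ - x)]addrC addrA subrK scalerBr !scalerA mulfV//.
  by rewrite scale1r.
have e2 : L *: (x - (x - L^-1 *: a)) = a.
  by rewrite subKr scalerA mulfV// scale1r.
have := sm (x - gamma *: v) x; rewrite /episcale invrK -/a e1 e2 => smx.
(* The stepsize restriction enters here: [L * gamma] serves as a convex weight between [a - v] and
   [a]. *)
have t01 : 0 <= L * gamma <= 1.
  by rewrite mulr_ge0 ?(ltW g0) ?(ltW L0)//= mulrC -ler_pdivlMr// mul1r.
have := reference_function_convex (a - v) a t01.
rewrite (_ : _ *: (a - v) + _ = a - (L * gamma) *: v); last first.
  by rewrite scalerBr scalerBl scale1r addrC addrA subrK.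
have Li : 0 <= L^-1 by rewrite invr_ge0 ltW.
move=> /(ler_wpM2l Li).
have -> : L^-1 * (L * gamma * phi (a - v) + (1 - L * gamma) * phi a)
  = gamma * phi (a - v) + L^-1 * phi a - gamma * phi a by field.
lra.
Qed.

End ReferenceFunction.

(** * Borel measurability of vector-valued maps *)

Section BorelVectors.
Context {R : realType} {n : nat}.

Lemma continuous_measurable_rV m (h : 'rV[R]_n -> 'rV[R]_m) :
  continuous h ->
  measurable_fun [set: borel_rV R n] (h : borel_rV R n -> borel_rV R m).
Proof.
move=> ch.
apply: (measurability (@open 'rV[R]_m : set (set (borel_rV R m)))) => //.
move=> _ [U oU <-].
by rewrite setTI; apply: sub_sigma_algebra; exact: open_comp.
Qed.

Lemma continuous_measurable_rV_real (h : 'rV[R]_n -> R) :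
  continuous h -> measurable_fun [set: borel_rV R n] (h : borel_rV R n -> R).
Proof.
move=> ch; apply: (measurability _ (RGenOpens.measurableE R)) => // _ [U + <-].
move=> [a [b ->]]; rewrite setTI; apply: sub_sigma_algebra.
by apply: open_comp => //; exact: itv_open.
Qed.

Lemma measurable_coord (i : 'I_n) :
  measurable_fun [set: borel_rV R n] (fun v : borel_rV R n => v 0 i).
Proof.
apply: continuous_measurable_rV_real; exact: (@coord_continuous R 1 n 0 i).
Qed.

(** Rational centres and radii [1 / (k + 1)] keep the index type countable, so these boxes can serve
    as a countable base. *)
Definition rational_box (c : 'rV[rat]_n * nat) : set 'rV[R]_n :=
  [set v | forall i, ball (ratr (c.1 0 i) : R) c.2.+1%:R^-1 (v 0 i)].

(** With a radius below [e / 2] and a rational centre within that radius of [v], the triangle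
    inequality keeps the box inside the [e]-ball. *)
Lemma rational_box_subset (U : set 'rV[R]_n) v : open U -> U v ->
  exists c, rational_box c `<=` U /\ rational_box c v.
Proof.
move=> oU Uv; have /nbhs_ballP[e /= e0 eU] : nbhs v U by exact: open_nbhs_nbhs.
have [k ke] : exists k : nat, k.+1%:R^-1 < e / 2.
  have e2 : 0 < e / 2 by rewrite divr_gt0.
  have [N _ /(_ N (leqnn N)) /= NP] := near_infty_natSinv_lt (PosNum e2).
  by exists N.
have k0 : 0 < k.+1%:R^-1 :> R by rewrite invr_gt0.
have qP i : {q : rat | ball (ratr q : R) k.+1%:R^-1 (v 0 i)}.
  apply: cid.
  have [|q] := @rat_in_itvoo R (v 0 i - k.+1%:R^-1) (v 0 i + k.+1%:R^-1).
    by rewrite ltrD2l gtrN.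
  rewrite in_itv/= => /andP[q1 q2]; exists q.
  by rewrite /ball /= ltr_distl q1 q2.
exists (\row_i projT1 (qP i), k); split => [w wc|i]; last first.
  by rewrite /= mxE; case: (qP i).
apply: eU; split=> // i j; rewrite (ord1 i).
have := wc j; rewrite /= mxE; case: (qP j) => q /= qv qw.
have -> : e = e / 2 + e / 2 by lra.
apply: (@ball_triangle _ _ (ratr q : R)).
  by apply: ball_sym; apply: le_ball qv; exact: ltW.
by apply: le_ball qw; exact: ltW.
Qed.

(** The sigma-algebra is generated by open sets, not by coordinates, so second countability is used:
    an open set is a countable union of boxes, and the preimage of a box is a finite intersection of
    coordinate preimages. *)
Lemma measurable_fun_rV d (T : measurableType d) (X : T -> 'rV[R]_n) :
  (forall i, measurable_fun [set: T] (fun w => X w 0 i)) ->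
  measurable_fun [set: T] (X : T -> borel_rV R n).
Proof.
move=> mX.
apply: (measurability (@open 'rV[R]_n : set (set (borel_rV R n)))) => //.
move=> _ [U oU <-].
pose D := [set c | rational_box c `<=` U].
have -> : U = \bigcup_(c in D) rational_box c.
  apply/seteqP; split => [v Uv|v [c]]; last by move=> /[apply].
  by have [c [cU cv]] := rational_box_subset oU Uv; exists c.
rewrite setTI preimage_bigcup bigcup_mkcond.
apply: countable_bigcupT_measurable => // c; case: ifPn => // _.
rewrite (_ : _ @^-1` _ = \bigcap_(i in [set: 'I_n])
    ((fun w => X w 0 i) @^-1` ball (ratr (c.1 0 i) : R) c.2.+1%:R^-1)).
  apply: fin_bigcap_measurable => // i _; rewrite -[X in measurable X]setTI.
  by apply: mX => //; exact: measurable_ball.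
by apply/seteqP; split => [w wc i _|w wc i]; exact: wc.
Qed.

End BorelVectors.

(** * Probability kernels and disintegration of a joint law *)

Section ConstKernel.
Context d d' (T : measurableType d) (T' : measurableType d') (R : realType).
Variable P : probability T R.

Definition const_kernel (_ : T') : {measure set T -> \bar R} := P.

Let measurable_const_kernel U : measurable U ->
  measurable_fun [set: T'] (const_kernel ^~ U).
Proof. by move=> _; exact: measurable_cst. Qed.

HB.instance Definition _ :=
  isKernel.Build _ _ T' T R const_kernel measurable_const_kernel.

Let const_kernel_prob t : const_kernel t [set: T] = 1%E.
Proof. exact: probability_setT. Qed.

HB.instance Definition _ :=
  Kernel_isProbability.Build _ _ T' T R const_kernel const_kernel_prob.

End ConstKernel.

Section CompKernel.
Context d0 d1 d2 (T0 : measurableType d0) (T1 : measurableType d1)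
  (T2 : measurableType d2) (R : realType).
Variables (Q : R.-pker T1 ~> T2) (X : T0 -> T1).
Hypothesis mX : measurable_fun [set: T0] X.

(** The measurability proof is an argument so that the kernel structure, which depends on it, can be
    inferred from the term. *)
Definition comp_kernel of measurable_fun [set: T0] X :=
  fun t => Q (X t) : {measure set T2 -> \bar R}.

Let measurable_comp_kernel U : measurable U ->
  measurable_fun [set: T0] (comp_kernel mX ^~ U).
Proof.
by move=> mU; exact: (measurableT_comp (measurable_kernel Q U mU) mX).
Qed.

HB.instance Definition _ :=
  isKernel.Build _ _ T0 T2 R (comp_kernel mX) measurable_comp_kernel.

Let comp_kernel_prob t : comp_kernel mX t [set: T2] = 1%E.
Proof. exact: prob_kernel. Qed.

HB.instance Definition _ :=
  Kernel_isProbability.Build _ _ T0 T2 R (comp_kernel mX) comp_kernel_prob.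

End CompKernel.

Section Disintegration.
Local Open Scope ereal_scope.
Context d d1 d2 (T : measurableType d) (T1 : measurableType d1)
  (T2 : measurableType d2) (R : realType).
Variables (P : probability T R) (Q : R.-pker T1 ~> T2).
Variables (X : T -> T1) (G : T -> T2).
Hypothesis mX : measurable_fun [set: T] X.
Hypothesis mG : measurable_fun [set: T] G.
Hypothesis XG : forall A B, measurable A -> measurable B ->
  P (X @^-1` A `&` G @^-1` B) = \int[P]_(w in X @^-1` A) Q (X w) B.

(* [kcomp] composes kernels only, so [P] is turned into a kernel from [unit];
   the joint law of [(X, G)] is then recognized on measurable rectangles. *)
Lemma integral_disintegration (h : T1 * T2 -> \bar R) :
  (forall z, 0 <= h z) -> measurable_fun [set: T1 * T2] h ->
  \int[P]_w h (X w, G w) = \int[P]_w \int[Q (X w)]_v h (X w, v).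
Proof.
move=> h0 mh.
have mXG : measurable_fun [set: T] (fun w => (X w, G w)).
  exact: measurable_fun_pair.
have mX2 : measurable_fun [set: unit * T] (X \o snd).
  exact: measurableT_comp.
have mgraph : measurable_fun [set: (unit * T) * T2]
    (fun p => (X p.1.2, p.2)).
  apply: measurable_fun_pair => //.
  by apply: (measurableT_comp mX2).
(* [l] draws [w] from [P], [k2] draws [v] from [Q (X w)], and [k3] records the pair [(X w, v)]; [J]
   is the law of that pair. *)
pose l : R.-sfker unit ~> T := const_kernel P.
pose k2 : R.-sfker _ ~> _ := comp_kernel Q mX2.
pose k3 : R.-sfker _ ~> _ := kdirac mgraph.
pose k : R.-sfker _ ~> _ := k2 \; k3.
pose J : {measure set (T1 * T2) -> \bar R} := (l \; k) tt.
have JE (h' : T1 * T2 -> \bar R) : (forall z, 0 <= h' z) ->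
    measurable_fun [set: T1 * T2] h' ->
    \int[J]_z h' z = \int[P]_w \int[Q (X w)]_v h' (X w, v).
  move=> h'0 mh'; rewrite (integral_kcomp l k tt h'0 mh').
  apply: eq_integral => w _.
  rewrite (integral_kcomp k2 k3 (tt, w) h'0 mh').
  apply: eq_integral => v _; rewrite integral_dirac//.
  by rewrite diracT mul1e.
pose mfXG := isMeasurableFun.Build _ _ _ _ _ mXG.
pose XG' : {mfun T >-> (T1 * T2)%type} := HB.pack (fun w => (X w, G w)) mfXG.
have JXG S : measurable S -> distribution P XG' S = J S.
  apply: (measure_unique [set A `*` B | A in measurable & B in measurable]
    (fun=> setT)).
  - exact: measurable_prod_measurableType.
  - move=> _ _ [A mA [B mB <-]] [A' mA' [B' mB' <-]].
    exists (A `&` A'); first exact: measurableI.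
    by exists (B `&` B'); [exact: measurableI|rewrite setXI].
  - by move=> _; exists setT => //; exists setT => //; rewrite setXTT.
  - by rewrite bigcup_const.
  - move=> _ [A mA [B mB <-]].
    have mAB : measurable (A `*` B) by exact: measurableX.
    have -> : J (A `*` B) = \int[J]_z (\1_(A `*` B) z)%:E.
      by rewrite integral_indic// setIT.
    rewrite JE; last exact/measurable_EFinP/measurable_indic; last first.
      by move=> z; rewrite lee_fin.
    rewrite [LHS](XG mA mB) [LHS]integral_mkcond; apply: eq_integral => w _.
    rewrite patchE; case: ifPn => [/set_mem|/negP] XA; last first.
      apply/esym/integral0_eq => v _; rewrite indicE memNset//= => -[XA' _].
      by apply: XA; exact/mem_set.
    rewrite -[B in LHS]setIT -integral_indic//; apply: eq_integral => v _.
    congr _%:E; rewrite !indicE; congr (nat_of_bool _)%:R.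
    by apply/idP/idP => [/set_mem Bv|/set_mem[_ Bv]]; exact/mem_set.
  - by move=> _; rewrite (le_lt_trans (probability_le1 _ _))// ltry.
transitivity (\int[distribution P XG']_z h z).
  by rewrite ge0_integral_distribution.
rewrite -JE//; apply: eq_measure_integral => S mS _.
by rewrite -JXG.
Qed.

End Disintegration.

(** * Measurability and expectation of the oracle noise *)

Section NoiseBound.
Context {R : realType} {n : nat} (phi f : 'rV[R]_n -> R).
Hypothesis hphi : reference_function phi.
Hypothesis f_C1 : C1 f.

Lemma measurable_grad_conj :
  measurable_fun [set: borel_rV R n]
    (grad_conj phi : borel_rV R n -> borel_rV R n).
Proof. exact: (continuous_measurable_rV (continuous_grad_conj hphi)). Qed.

Lemma measurable_grad :
  measurable_fun [set: borel_rV R n] (grad f : borel_rV R n -> borel_rV R n).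
Proof. by apply: continuous_measurable_rV; case: f_C1. Qed.

Lemma measurable_phi :
  measurable_fun [set: borel_rV R n] (phi : borel_rV R n -> R).
Proof.
exact: (continuous_measurable_rV_real (reference_function_continuous hphi)).
Qed.

(** Passing to coordinates reduces the claim to real subtraction, with no need to compare the Borel
    sets of a product with the product sigma-algebra. *)
Lemma measurable_funB_rV d (T : measurableType d) (X Y : T -> 'rV[R]_n) :
  measurable_fun [set: T] (X : T -> borel_rV R n) ->
  measurable_fun [set: T] (Y : T -> borel_rV R n) ->
  measurable_fun [set: T] ((fun w => X w - Y w) : T -> borel_rV R n).
Proof.
move=> mX mY; apply: measurable_fun_rV => i.
rewrite (_ : (fun w => _) = (fun w => X w 0 i - Y w 0 i)); last first.
  by apply/funext => w; rewrite !mxE.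
apply: measurable_funB.
  exact: (measurableT_comp (measurable_coord i) mX).
exact: (measurableT_comp (measurable_coord i) mY).
Qed.

Lemma measurable_funZ_rV d (T : measurableType d) (a : R) (X : T -> 'rV[R]_n) :
  measurable_fun [set: T] (X : T -> borel_rV R n) ->
  measurable_fun [set: T] ((fun w => a *: X w) : T -> borel_rV R n).
Proof.
move=> mX; apply: measurable_fun_rV => i.
rewrite (_ : (fun w => _) = (fun w => a * X w 0 i)); last first.
  by apply/funext => w; rewrite !mxE.
apply: measurable_funM; first exact: measurable_cst.
exact: (measurableT_comp (measurable_coord i) mX).
Qed.

Lemma measurable_noise d (T : measurableType d) (X Y : T -> 'rV[R]_n) :
  measurable_fun [set: T] (X : T -> borel_rV R n) ->
  measurable_fun [set: T] (Y : T -> borel_rV R n) ->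
  measurable_fun [set: T]
    (fun w => phi (grad_conj phi (grad f (X w)) - grad_conj phi (Y w))).
Proof.
move=> mX mY; apply: (measurableT_comp measurable_phi).
apply: measurable_funB_rV.
  apply: (measurableT_comp measurable_grad_conj).
  exact: (measurableT_comp measurable_grad).
exact: (measurableT_comp measurable_grad_conj).
Qed.

(** Disintegration rewrites the left side as the [P]-average of the noise integrals at the points
    [X w]; each is at most [c], and [P] has mass 1. *)
Lemma expected_noise_le (Q : oracle R n) (c : R) d (T : measurableType d)
    (P : probability T R) (X G : T -> 'rV[R]_n) :
  (forall u, (\int[Q u]_v
    (phi (grad_conj phi (grad f u) - grad_conj phi v))%:E <= c%:E)%E) ->
  measurable_fun [set: T] (X : T -> borel_rV R n) ->
  measurable_fun [set: T] (G : T -> borel_rV R n) ->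
  conditionally_distributed P Q X G ->
  (\int[P]_w (phi (grad_conj phi (grad f (X w)) - grad_conj phi (G w)))%:E
    <= c%:E)%E.
Proof.
move=> Qc mX mG XG.
pose h (z : borel_rV R n * borel_rV R n) :=
  (phi (grad_conj phi (grad f z.1) - grad_conj phi z.2))%:E.
have h0 z : (0 <= h z)%E by rewrite lee_fin reference_function_ge0.
have mh : measurable_fun setT h.
  by apply/measurable_EFinP/measurable_noise; [exact: measurable_fst|
     exact: measurable_snd].
rewrite (integral_disintegration mX mG XG h0 mh).
rewrite -[leRHS]mule1 -(probability_setT P) -integral_cst//.
apply: ge0_le_integral => //.
- by move=> w _; exact: integral_ge0.
- have mQ := measurable_fun_integral_sfinite_kernel h Q h0 mh.
  exact: (measurableT_comp mQ mX).
Qed.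

End NoiseBound.

(** * Telescoping along trajectories and passage to expectations *)

Theorem theorem3p1 (R : realType) (n : nat)
    (phi f : 'rV[R]_n -> R) (L sigma gamma : R)
    (hphi : reference_function phi)
    (f_C1 : C1 f)
    (L_gt0 : 0 < L)
    (f_smooth : anisotropically_smooth phi L f)
    (f_bounded : has_lbound (range f))
    (Q : oracle R n)
    (Q_noise : forall x : 'rV[R]_n,
      (\int[Q x]_v (phi (grad_conj phi (grad f x) - grad_conj phi v))%:E
        <= (sigma ^+ 2)%:E)%E)
    (gamma_gt0 : 0 < gamma) (gamma_le : gamma <= L^-1)
    (d : measure_display) (Omega : measurableType d) (P : probability Omega R)
    (x0 : 'rV[R]_n)
    (x : nat -> Omega -> 'rV[R]_n)
    (g : nat -> {mfun Omega >-> borel_rV R n})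
    (x_init : forall w, x 0%N w = x0)
    (x_step : forall k w, x k.+1 w = x k w - gamma *: grad_conj phi (g k w))
    (g_oracle : forall k, conditionally_distributed P Q (x k) (g k))
    (K : nat) (K_ge1 : (1 <= K)%N) :
  ('E_P[fun w => (K%:R^-1 *
          \sum_(k < K) phi (grad_conj phi (grad f (x k w))))%R]
   <= ((f x0 - inf (range f)) / (gamma * K%:R) + sigma ^+ 2)%:E)%E.
Proof.
have mx k : measurable_fun [set: Omega] (x k : Omega -> borel_rV R n).
  elim: k => [|k IH].
    rewrite (_ : x 0%N = cst x0); last exact/funext.
    exact: (@measurable_cst _ _ Omega (borel_rV R n) setT x0).
  rewrite (_ : x k.+1 = fun w => x k w - gamma *: grad_conj phi (g k w));
    last exact/funext.
  apply: measurable_funB_rV => //; apply: measurable_funZ_rV.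
  exact: (measurableT_comp (measurable_grad_conj hphi)).
pose N k w := phi (grad_conj phi (grad f (x k w)) - grad_conj phi (g k w)).
pose S k w := phi (grad_conj phi (grad f (x k w))).
have N0 k w : 0 <= N k w by exact: reference_function_ge0.
have S0 k w : 0 <= S k w by exact: reference_function_ge0.
have mN k : measurable_fun setT (N k) by exact: measurable_noise.
have mS k : measurable_fun setT (S k).
  apply: (measurableT_comp (measurable_phi hphi)).
  apply: (measurableT_comp (measurable_grad_conj hphi)).
  exact: (measurableT_comp (measurable_grad f_C1)).
have K0 : 0 < K%:R :> R by rewrite ltr0n.
(* [f_bounded] makes [inf] a genuine lower bound rather than a default value. *)
have inf_le y : inf (range f) <= f y by apply: ge_inf => //; exists y.
have telescope w m : gamma * \sum_(k < m) S k w <=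
    f x0 - f (x m w) + gamma * \sum_(k < m) N k w.
  elim: m => [|m IH]; first by rewrite !big_ord0 x_init subrr !mulr0 addr0.
  rewrite !big_ord_recr /= x_step.
  have gL : 0 < gamma <= L^-1 by rewrite gamma_gt0.
  have := anisotropic_descent hphi (x m w) (grad_conj phi (g m w))
    L_gt0 f_smooth gL.
  rewrite -/(S m w) -/(N m w); lra.
have sumN0 w : 0 <= \sum_(k < K) N k w by apply: sumr_ge0 => k _; exact: N0.
pose c := (f x0 - inf (range f)) / (gamma * K%:R).
have c0 : 0 <= c by rewrite divr_ge0 ?subr_ge0// mulr_ge0// ltW.
have mean_le w : K%:R^-1 * \sum_(k < K) S k w
    <= c + K%:R^-1 * \sum_(k < K) N k w.
  have bound : gamma * \sum_(k < K) S k w <=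
      f x0 - inf (range f) + gamma * \sum_(k < K) N k w.
    by apply: le_trans (telescope w K) _; rewrite lerD2r lerB.
  (* Multiplying by [gamma * K] clears both denominators. *)
  rewrite -(ler_pM2l (mulr_gt0 gamma_gt0 K0)).
  have -> : gamma * K%:R * (c + K%:R^-1 * \sum_(k < K) N k w) =
      f x0 - inf (range f) + gamma * \sum_(k < K) N k w.
    by rewrite /c; field; rewrite !gt_eqF.
  by rewrite -mulrA mulVKf ?gt_eqF.
rewrite unlock -/c.
have mNs : measurable_fun setT (fun w => \sum_(k < K) N k w).
  exact: measurable_sum.
(* Both integrands are nonnegative and measurable, so monotonicity and, thanks to [c0], additivity
   hold in the extended reals without any integrability of the iterates. *)
apply: (@le_trans _ _
    (\int[P]_w (c%:E + (K%:R^-1)%:E * \sum_(k < K) (N k w)%:E))%E).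
  apply: ge0_le_integral => //.
  - move=> w _; rewrite lee_fin mulr_ge0 ?invr_ge0 ?ler0n//.
    by apply: sumr_ge0 => k _; exact: S0.
  - apply/measurable_EFinP/measurable_funM => //.
    exact: (measurable_sum _ (fun k : 'I_K => mS k)).
  - under eq_fun do rewrite sumEFin -EFinM -EFinD.
    apply/measurable_EFinP/measurable_funD => //.
    exact: measurable_funM.
  - by move=> w _; rewrite sumEFin -EFinM -EFinD lee_fin; exact: mean_le.
rewrite ge0_integralD//; last 2 first.
- by move=> w _; rewrite sumEFin -EFinM lee_fin mulr_ge0// invr_ge0.
- under eq_fun do rewrite sumEFin -EFinM.
  by apply/measurable_EFinP/measurable_funM.
rewrite integral_cst// [X in (_ * X)%E](_ : _ = 1%E); last first.
  exact: probability_setT.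
rewrite mule1 EFinD leeD2l//.
rewrite ge0_integralZl_EFin ?invr_ge0 ?ler0n//; last 2 first.
- by move=> w _; rewrite sumEFin lee_fin.
- by under eq_fun do rewrite sumEFin; exact/measurable_EFinP.
rewrite ge0_integral_sum//; last 2 first.
- by move=> k; exact/measurable_EFinP.
- by move=> k w _; rewrite lee_fin.
apply: (@le_trans _ _ ((K%:R^-1)%:E * \sum_(k < K) (sigma ^+ 2)%:E)%E).
  apply: lee_wpmul2l; first by rewrite lee_fin invr_ge0 ler0n.
  apply: lee_sum => k _.
  exact: (expected_noise_le hphi f_C1 Q_noise (mx k) _ (g_oracle k)).
rewrite sumEFin -EFinM sumr_const card_ord -(mulr_natl (sigma ^+ 2)).
by rewrite mulKf ?gt_eqF.
Qed.
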